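(* Let $\{A,S(0),\Pi(0)\}$ be a triple of matrices, where $A$ and $S(0)$ are $n\times n$ and $\Pi(0)=\begin{bmatrix}\vartheta_1 & \vartheta_2\end{bmatrix}$ is $n\times m$ with $n\times h$ blocks $\vartheta_1,\vartheta_2$, satisfying $$AS(0)-S(0)A^*=\Pi(0)\,j\,\Pi(0)^*,\qquad S(0)=S(0)^*.$$ Let $Q$ be an $n\times n$ matrix with $Q^2=A$, and let $f_1,f_2$ be $n\times h$ matrices with $$-\mathrm{i}Q(f_1-f_2)=\vartheta_1,\qquad f_1+f_2=\vartheta_2.$$ For $x\in\mathcal I$ put $$\Lambda_1(x)=-\mathrm{i}Q\big(\mathrm{e}^{\mathrm{i}xQ}f_1-\mathrm{e}^{-\mathrm{i}xQ}f_2\big),\quad \Lambda_2(x)=\mathrm{e}^{\mathrm{i}xQ}f_1+\mathrm{e}^{-\mathrm{i}xQ}f_2,\quad \Pi(x)=\begin{bmatrix}\Lambda_1(x)&\Lambda_2(x)\end{bmatrix},$$ $$S(x)=S(0)+\int_0^x\Lambda_2(\xi)\Lambda_2(\xi)^*\,d\xi .$$ At the points $x$ where $S(x)$ is invertible, define the $h\times h$ matrix function $$\widetilde u(x)=2\big(X_{12}(x)+X_{21}(x)+X_{22}(x)^2\big),\qquad X_{ik}(x)=\Lambda_i(x)^*S(x)^{-1}\Lambda_k(x).$$ Let $\lambda\in\mathbb C$ not be an eigenvalue of $A$, let $y(x,\lambda)\in\mathbb C^h$ satisfy $-y''(x,\lambda)=\lambda y(x,\lambda)$ on $\mathcal I$,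 and put $Y_0(x,\lambda)=\begin{bmatrix}y(x,\lambda)\\ y'(x,\lambda)\end{bmatrix}\in\mathbb C^m$. Then, at the points of invertibility of $S(x)$, the function $$\widetilde y(x,\lambda)=\begin{bmatrix}I_h&0\end{bmatrix}w_A(x,\lambda)Y_0(x,\lambda),\qquad w_A(x,\lambda)=I_m-j\,\Pi(x)^*S(x)^{-1}(A-\lambda I_n)^{-1}\Pi(x),$$ satisfies the matrix Schrödinger equation $$-\widetilde y''(x,\lambda)+\widetilde u(x)\widetilde y(x,\lambda)=\lambda\,\widetilde y(x,\lambda).$$
   Context: $n,h$ are positive integers and $m=2h$. All matrices have complex entries; $M^*$ is the conjugate transpose, $I_k$ the $k\times k$ identity matrix, $\mathrm i$ the imaginary unit, and $j=\begin{bmatrix}0&I_h\\-I_h&0\end{bmatrix}$ ($m\times m$). $\mathcal I\subset\mathbb R$ is a finite or infinite interval with $0\in\mathcal I$, and $x\in\mathcal I$. The prime denotes $d/dx$. *)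

(* Defs.v *)
From HB Require Import structures.
From mathcomp Require Import all_boot all_order all_algebra.
From mathcomp Require Import complex.
From mathcomp Require Import all_classical all_reals all_analysis.

Set Implicit Arguments.
Unset Strict Implicit.
Unset Printing Implicit Defensive.

Import Order.TTheory GRing.Theory Num.Theory.
Import numFieldNormedType.Exports.

Local Open Scope classical_set_scope.
Local Open Scope ring_scope.
Local Open Scope complex_scope.
Local Open Scope sesquilinear_scope.

(* The topology on [R[i]], hence on complex matrices, is the one given by the
   complex modulus. The library provides it for a generic
   [numClosedFieldType]; the copy makes it found on the type [R[i]] itself. *)
HB.instance Definition _ (R : realType) := NormedModule.copy R[i] R[i]^o.

(* Derivative, in the real variable, of a complex matrix function, relative to
   a set [D] of reals: the difference quotient at [x] is taken along the points
   of [D] only. At an interior point of [D] it is the usual two-sided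
   derivative, at an endpoint of an interval [D] the one-sided one.
   [derive_within D f x] is meaningful only if [derivable_within D f x]. *)
Definition diff_quotient (R : realType) (m n : nat) (f : R -> 'M[R[i]]_(m, n))
    (x t : R) : 'M[R[i]]_(m, n) :=
  ((t - x)^-1)%:C *: (f t - f x).

Definition derivable_within (R : realType) (m n : nat) (D : set R)
    (f : R -> 'M[R[i]]_(m, n)) (x : R) : Prop :=
  cvg (diff_quotient f x t @[t --> within D x^']).

Definition derive_within (R : realType) (m n : nat) (D : set R)
    (f : R -> 'M[R[i]]_(m, n)) (x : R) : 'M[R[i]]_(m, n) :=
  lim (diff_quotient f x t @[t --> within D x^']).

Definition mexp (R : realType) (n : nat) (M : 'M[R[i]]_n) : 'M[R[i]]_n :=
  limn [series (k`!%:R)^-1 *: M ^+ k]_k.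

(* Oriented: [b] may be smaller than [a]. *)
Definition oriented_integral (R : realType) (a b : R) (f : R -> R) : R :=
  if a <= b then \int[lebesgue_measure]_(t in `[a, b]) f t
  else - \int[lebesgue_measure]_(t in `[b, a]) f t.

Definition mx_integral (R : realType) (m n : nat) (a b : R)
    (F : R -> 'M[R[i]]_(m, n)) : 'M[R[i]]_(m, n) :=
  \matrix_(k, l) (oriented_integral a b (fun t => complex.Re (F t k l))
              +i* oriented_integral a b (fun t => complex.Im (F t k l))).

Definition jmx (R : realType) (h : nat) : 'M[R[i]]_(h + h) :=
  block_mx 0 1%:M (- 1%:M) 0.

Section Darboux.
Variables (R : realType) (n h : nat).
Variables (A S0 Q : 'M[R[i]]_n) (f1 f2 : 'M[R[i]]_(n, h)).

Definition Lambda1 (x : R) : 'M[R[i]]_(n, h) :=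
  (- 'i%C) *: (Q *m (mexp (('i%C * x%:C) *: Q) *m f1
                   - mexp (- (('i%C * x%:C) *: Q)) *m f2)).

Definition Lambda2 (x : R) : 'M[R[i]]_(n, h) :=
  mexp (('i%C * x%:C) *: Q) *m f1 + mexp (- (('i%C * x%:C) *: Q)) *m f2.

Definition Pimx (x : R) : 'M[R[i]]_(n, h + h) :=
  row_mx (Lambda1 x) (Lambda2 x).

Definition Smx (x : R) : 'M[R[i]]_n :=
  S0 + mx_integral 0 x (fun xi => Lambda2 xi *m (Lambda2 xi)^t*).

(* [invmx] is the inverse only where [Smx x \in unitmx]. *)
Definition Xmx (La Lb : R -> 'M[R[i]]_(n, h)) (x : R) : 'M[R[i]]_h :=
  (La x)^t* *m invmx (Smx x) *m Lb x.

Definition utilde (x : R) : 'M[R[i]]_h :=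
  2%:R *: (Xmx Lambda1 Lambda2 x + Xmx Lambda2 Lambda1 x
           + Xmx Lambda2 Lambda2 x ^+ 2).

Definition wA (lambda : R[i]) (x : R) : 'M[R[i]]_(h + h) :=
  1%:M - jmx R h *m (Pimx x)^t* *m invmx (Smx x)
           *m invmx (A - lambda%:M) *m Pimx x.

(* [y] is a solution and [dy] stands for its derivative. *)
Definition ytilde (lambda : R[i]) (y dy : R -> 'cV[R[i]]_h) (x : R)
    : 'cV[R[i]]_h :=
  row_mx 1%:M 0 *m wA lambda x *m col_mx (y x) (dy x).

End Darboux.

(* [z] is twice differentiable and satisfies [- z'' + u z = lambda z] at every
   point of [D], with derivatives relative to [D]. *)
Definition schrodinger_on (R : realType) (h : nat) (D : set R)
    (u : R -> 'M[R[i]]_h) (lambda : R[i]) (z : R -> 'cV[R[i]]_h) : Prop :=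
  forall x : R, D x ->
    [/\ derivable_within D z x,
        derivable_within D (derive_within D z) x
      & - derive_within D (derive_within D z) x + u x *m z x
        = lambda *: z x].

(* Main.v *)
Require Import Defs.
From HB Require Import structures.
From mathcomp Require Import all_boot all_order all_algebra.
From mathcomp Require Import complex.
From mathcomp Require Import all_classical all_reals all_analysis.
From mathcomp Require Import ring.

Set Implicit Arguments.
Unset Strict Implicit.
Unset Printing Implicit Defensive.

Import Order.TTheory GRing.Theory Num.Theory.
Import numFieldNormedType.Exports.

Local Open Scope classical_set_scope.
Local Open Scope ring_scope.
Local Open Scope complex_scope.
Local Open Scope sesquilinear_scope.

(** Write prime for the derivative and [v = S^-1 (A - lambda)^-1 Pi Y0], so that
    [ytilde = y - Lambda2^* v].  The exponential formulas give
    [Lambda1' = A Lambda2], [Lambda2' = - Lambda1], and the fundamental theorem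
    of calculus gives [S' = Lambda2 Lambda2^*].  Three facts then carry the proof.

    - The identity [A S - S A^* = Lambda1 Lambda2^* - Lambda2 Lambda1^*] holds
      for every [x]: it holds at [0] by hypothesis and the difference of its two
      sides has derivative zero ([Smx_identity]).
    - In [(Lambda1 y + Lambda2 y')' = A Lambda2 y - lambda Lambda2 y] the
      resolvent cancels, so [S v] has derivative [Lambda2 y] and
      [v' = S^-1 Lambda2 ytilde] ([has_derive_v]).
    - Multiplying the identity by [v] expresses [A^* v] through [lambda v],
      [ytilde] and [y' + Lambda1^* v] ([adjoint_resolvent]).

    Differentiating [ytilde] twice and eliminating [A^* v] gives
    [ytilde'' = - lambda ytilde + 2 (X12 + X21 + X22^2) ytilde]
    ([schrodinger_dressed]).

    All derivatives are limits of difference quotients along the set [D] of the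
    points of the interval where [S] is invertible.  These limits are unique
    because [D] accumulates at each of its points: the interval does, and [S]
    stays invertible near a point of [D] since its determinant is continuous
    ([within_near_proper]).  The calculus is reduced to real functions through
    the real and imaginary parts of the entries; in particular an entry of
    [exp (x M)] is a pair of real power series whose coefficients are dominated
    by [b ^ k / k!], hence can be differentiated term by term
    ([has_derive_mexp]). *)

(** * Limits of complex matrices *)

Section Limits.
Variable R : realType.
Local Notation C := R[i].

Lemma cvg_mxP (T : Type) (F : set_system T) (FF : Filter F) m n
    (f : T -> 'M[C]_(m, n)) (l : 'M[C]_(m, n)) :
  f x @[x --> F] --> l <-> forall i j, f x i j @[x --> F] --> l i j.
Proof.
split=> [fl i j|fl].
  exact: (cvg_comp _ _ fl (@coord_continuous C m n i j l)).
apply/cvgrPdist_lt => e e0.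
have key : \forall x \near F, forall i j, `|l i j - f x i j| < e.
  apply: filter_forall => i; apply: filter_forall => j.
  by have /cvgrPdist_lt/(_ _ e0) := fl i j.
apply: filterS key => x lx.
have : ball l e (f x) by split.
by rewrite -ball_normE.
Qed.

Lemma Im_le_normc (z : C) : `|complex.Im z|%:C <= `|z|.
Proof.
have := normc_ge_Re (z * 'i%C).
by rewrite ReiNIm normrN normrM complexiE normCi mulr1.
Qed.

Lemma normc_real (x : R) : `|x%:C| = `|x|%:C.
Proof. by rewrite normc_def /= expr0n addr0 sqrtr_sqr. Qed.

Lemma cvg_complexP (T : Type) (F : set_system T) (FF : Filter F)
    (f : T -> C) (l : C) :
  f x @[x --> F] --> l <->
  (complex.Re (f x) @[x --> F] --> complex.Re l) /\
  (complex.Im (f x) @[x --> F] --> complex.Im l).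
Proof.
split=> [fl|[fr fi]].
  split; apply/cvgrPdist_lt => e e0.
  - have /cvgrPdist_lt/(_ e%:C) := fl.
    rewrite ltcR => /(_ e0); apply: filterS => x.
    have -> : complex.Re l - complex.Re (f x) = complex.Re (l - f x).
      by case: l {fl} => a b; case: (f x).
    move => lx; rewrite -ltcR; apply: le_lt_trans lx.
    exact: normc_ge_Re.
  - have /cvgrPdist_lt/(_ e%:C) := fl.
    rewrite ltcR => /(_ e0); apply: filterS => x.
    have -> : complex.Im l - complex.Im (f x) = complex.Im (l - f x).
      by case: l {fl} => a b; case: (f x).
    move => lx; rewrite -ltcR; apply: le_lt_trans lx.
    exact: Im_le_normc.
apply/cvgrPdist_lt => e e0.
have eE : e = (complex.Re e)%:C by rewrite RRe_real// gtr0_real.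
have e2 : 0 < complex.Re e / 2 by rewrite divr_gt0// -ltcR -eE.
move/cvgrPdist_lt/(_ _ e2) : fr => fr; move/cvgrPdist_lt/(_ _ e2) : fi => fi.
apply: filterS2 fr fi => x fr fi.
rewrite [l - f x]complexE eE (splitr (complex.Re e)) [ltRHS]raddfD.
apply: le_lt_trans (ler_normD _ _) _.
rewrite normrM complexiE normCi mul1r !normc_real.
have dRe : complex.Re (l - f x) = complex.Re l - complex.Re (f x).
  by case: (l) => a b; case: (f x).
have dIm : complex.Im (l - f x) = complex.Im l - complex.Im (f x).
  by case: (l) => a b; case: (f x).
by rewrite dRe dIm ltrD// ltcR.
Qed.


Section Operations.
Context {T : Type} {F : set_system T} {FF : Filter F}.

Lemma cvg_mulmx m n p (f : T -> 'M[C]_(m, n)) (g : T -> 'M[C]_(n, p))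
    (a : 'M[C]_(m, n)) (b : 'M[C]_(n, p)) :
  f x @[x --> F] --> a -> g x @[x --> F] --> b ->
  f x *m g x @[x --> F] --> a *m b.
Proof.
move=> /cvg_mxP fa /cvg_mxP gb; apply/cvg_mxP => i j.
under eq_cvg do rewrite mxE.
rewrite mxE; apply: cvg_big => [|k _]; first exact: add_continuous.
exact: cvgM (fa i k) (gb k j).
Qed.

Lemma cvg_scalemx m n (c : T -> C) (f : T -> 'M[C]_(m, n)) (k : C)
    (a : 'M[C]_(m, n)) :
  c x @[x --> F] --> k -> f x @[x --> F] --> a ->
  c x *: f x @[x --> F] --> k *: a.
Proof.
move=> ck /cvg_mxP fa; apply/cvg_mxP => i j.
under eq_cvg do rewrite mxE.
rewrite mxE; exact: cvgM ck (fa i j).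
Qed.

Lemma cvg_addmx m n (f g : T -> 'M[C]_(m, n)) (a b : 'M[C]_(m, n)) :
  f x @[x --> F] --> a -> g x @[x --> F] --> b ->
  f x + g x @[x --> F] --> a + b.
Proof. by move=> fa gb; exact: cvgD fa gb. Qed.

Lemma cvg_oppmx m n (f : T -> 'M[C]_(m, n)) (a : 'M[C]_(m, n)) :
  f x @[x --> F] --> a -> - f x @[x --> F] --> - a.
Proof. by move=> fa; exact: cvgN fa. Qed.

Lemma cvg_trmxC m n (f : T -> 'M[C]_(m, n)) (a : 'M[C]_(m, n)) :
  f x @[x --> F] --> a -> (f x)^t* @[x --> F] --> a^t*.
Proof.
move=> /cvg_mxP fa; apply/cvg_mxP => i j.
under eq_cvg do rewrite !mxE.
rewrite !mxE; apply/cvgrPdist_lt => e e0.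
have /cvgrPdist_lt/(_ _ e0) := fa j i.
by apply: filterS => x; rewrite -rmorphB norm_conjC.
Qed.

Lemma cvg_det n (f : T -> 'M[C]_n) (a : 'M[C]_n) :
  f x @[x --> F] --> a -> \det (f x) @[x --> F] --> \det a.
Proof.
move=> /cvg_mxP fa; rewrite /determinant.
apply: cvg_big => [|s _]; first exact: add_continuous.
apply: cvgM; first exact: cvg_cst.
apply: cvg_big => [|k _]; first exact: mul_continuous.
exact: fa.
Qed.

(** The entries of the adjugate are signed minors, so continuity of the
    determinant suffices. *)
Lemma cvg_adjugate n (f : T -> 'M[C]_n) (a : 'M[C]_n) :
  f x @[x --> F] --> a -> \adj (f x) @[x --> F] --> \adj a.
Proof.
move=> fa; apply/cvg_mxP => i j; rewrite mxE.
under eq_cvg do rewrite mxE.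
rewrite /cofactor; apply: cvgM; first exact: cvg_cst.
apply: cvg_det; apply/cvg_mxP => k l; rewrite !mxE.
under eq_cvg do rewrite !mxE.
by move/cvg_mxP : fa; exact.
Qed.

(** Cramer's rule.  The values must be invertible near the limit as well,
    because [invmx] is the identity on singular matrices. *)
Lemma cvg_invmx n (f : T -> 'M[C]_n) (a : 'M[C]_n) : a \in unitmx ->
  (\forall x \near F, f x \in unitmx) ->
  f x @[x --> F] --> a -> invmx (f x) @[x --> F] --> invmx a.
Proof.
move=> ua uf fa; rewrite /invmx ua.
apply: (@cvg_trans _ (((\det (f x))^-1 *: \adj (f x)) @[x --> F])).
  by apply: near_eq_cvg; apply: filterS uf => x ->.
apply: cvg_scalemx; last exact: cvg_adjugate.
apply: cvgV; last exact: cvg_det.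
by move: ua; rewrite unitmxE unitfE.
Qed.

End Operations.

End Limits.

(** * Derivatives relative to a set of reals *)

Section RelativeDerivative.
Variable R : realType.
Local Notation C := R[i].
Implicit Types (D : set R) (x : R).

(** The relational form of [derive_within]: naming the limit lets the
    differentiation rules compose without carrying differentiability. *)
Definition has_derive_within D m n (f : R -> 'M[C]_(m, n)) x
    (l : 'M[C]_(m, n)) : Prop :=
  diff_quotient f x t @[t --> within D x^'] --> l.

Lemma near_within_dnbhs D x : \forall t \near within D x^', D t /\ t != x.
Proof.
by apply: (@filterE _ (nbhs x)) => t tx Dt; split.
Qed.

Lemma has_derive_eq D m n (f g : R -> 'M[C]_(m, n)) x l : D x ->
  (forall t, D t -> f t = g t) ->
  has_derive_within D f x l -> has_derive_within D g x l.
Proof.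
move=> Dx fg; apply: cvg_trans; apply: near_eq_cvg.
apply: filterS (near_within_dnbhs D x) => t [Dt _].
by rewrite /diff_quotient !fg.
Qed.

(** This is what carries the equation satisfied by [y] on the interval over to
    the smaller set where [S] is invertible. *)
Lemma has_derive_sub D E m n (f : R -> 'M[C]_(m, n)) x l : D `<=` E ->
  has_derive_within E f x l -> has_derive_within D f x l.
Proof.
move=> DE; apply: cvg_trans; apply: cvg_app => P.
rewrite /nbhs/= => PE; rewrite /within/=.
by apply: (@filterS _ x^' _ _ _ _ PE) => t Et /DE.
Qed.

Lemma has_derive_cst D m n (a : 'M[C]_(m, n)) x :
  has_derive_within D (fun=> a) x 0.
Proof.
rewrite /has_derive_within /diff_quotient.
under eq_cvg do rewrite subrr scaler0.
exact: cvg_cst.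
Qed.

Lemma has_derive_add D m n (f g : R -> 'M[C]_(m, n)) x a b :
  has_derive_within D f x a -> has_derive_within D g x b ->
  has_derive_within D (fun t => f t + g t) x (a + b).
Proof.
move=> fa gb; rewrite /has_derive_within /diff_quotient.
under eq_cvg do rewrite opprD addrACA scalerDr.
exact: cvg_addmx fa gb.
Qed.

Lemma has_derive_opp D m n (f : R -> 'M[C]_(m, n)) x a :
  has_derive_within D f x a -> has_derive_within D (fun t => - f t) x (- a).
Proof.
move=> fa; rewrite /has_derive_within /diff_quotient.
under eq_cvg do rewrite -opprD scalerN.
exact: cvg_oppmx fa.
Qed.

Lemma has_derive_trmxC D m n (f : R -> 'M[C]_(m, n)) x a :
  has_derive_within D f x a ->
  has_derive_within D (fun t => (f t)^t*) x (a^t*).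
Proof.
move=> fa; rewrite /has_derive_within; apply: cvg_trans (cvg_trmxC fa).
apply: near_eq_cvg; apply: nearW => t; apply/matrixP => i j; rewrite !mxE /=.
rewrite rmorphM rmorphB; congr (_ * _); apply: conj_Creal.
by apply/complex_realP; exists (t - x)^-1.
Qed.

Lemma cvg_realC (T : Type) (F : set_system T) (FF : Filter F) (f : T -> R)
    (a : R) :
  f t @[t --> F] --> a -> (f t)%:C @[t --> F] --> a%:C.
Proof. by move=> fa; apply/cvg_complexP; split => //; exact: cvg_cst. Qed.

Lemma has_derive_cvg D m n (f : R -> 'M[C]_(m, n)) x a :
  has_derive_within D f x a -> f t @[t --> within D x^'] --> f x.
Proof.
move=> fa.
have : ((t - x)%:C *: diff_quotient f x t) + f x @[t --> within D x^'] -->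
    0%:C *: a + f x.
  apply: cvg_addmx; last exact: cvg_cst.
  apply: cvg_scalemx => //; apply: cvg_realC.
  rewrite -[X in _ --> X](subrr x); apply: cvgB; last exact: cvg_cst.
  move=> P Px; change (nbhs x (fun t => t != x -> D t -> P t)).
  by apply: (@filterS _ (nbhs x) _ _ _ _ Px) => t Pt _ _.
rewrite scale0r add0r; apply: cvg_trans; apply: near_eq_cvg.
apply: filterS (near_within_dnbhs D x) => t [Dt tx].
by rewrite /diff_quotient scalerA -rmorphM divff ?subr_eq0// scale1r subrK.
Qed.

(** The factors do not commute; the quotient splits as
    [f g - f0 g0 = (f - f0) g + f0 (g - g0)]. *)
Lemma has_derive_mulmx D m n p (f : R -> 'M[C]_(m, n)) (g : R -> 'M[C]_(n, p))
    x a b :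
  has_derive_within D f x a -> has_derive_within D g x b ->
  has_derive_within D (fun t => f t *m g t) x (a *m g x + f x *m b).
Proof.
move=> fa gb; rewrite /has_derive_within.
have gx := has_derive_cvg gb.
apply: cvg_trans (cvg_addmx (cvg_mulmx fa gx) (cvg_mulmx (cvg_cst _) gb)).
apply: near_eq_cvg; apply: nearW => t; rewrite /diff_quotient.
rewrite -scalemxAl -scalemxAr -scalerDr; congr (_ *: _).
by rewrite mulmxBl mulmxBr addrA subrK.
Qed.

Lemma has_derive_mulmxr D m n p (f : R -> 'M[C]_(m, n)) (b : 'M[C]_(n, p))
    x a :
  has_derive_within D f x a ->
  has_derive_within D (fun t => f t *m b) x (a *m b).
Proof.
move=> fa; have := has_derive_mulmx fa (@has_derive_cst D _ _ b x).
by rewrite mulmx0 addr0.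
Qed.

Lemma has_derive_mulmxl D m n p (b : 'M[C]_(m, n)) (f : R -> 'M[C]_(n, p))
    x a :
  has_derive_within D f x a ->
  has_derive_within D (fun t => b *m f t) x (b *m a).
Proof.
move=> fa; have := has_derive_mulmx (@has_derive_cst D _ _ b x) fa.
by rewrite mul0mx add0r.
Qed.

(** Resolvent identity: [f^-1 - f0^-1 = - f^-1 (f - f0) f0^-1]. *)
Lemma has_derive_invmx D n (f : R -> 'M[C]_n) x a :
  f x \in unitmx -> (forall t, D t -> f t \in unitmx) ->
  has_derive_within D f x a ->
  has_derive_within D (fun t => invmx (f t)) x
    (- (invmx (f x) *m a *m invmx (f x))).
Proof.
move=> ux uD fa.
have uN : \forall t \near within D x^', f t \in unitmx.
  by apply: filterS (near_within_dnbhs D x) => t [/uD].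
have fi : invmx (f t) @[t --> within D x^'] --> invmx (f x).
  exact: cvg_invmx ux uN (has_derive_cvg fa).
have fc : (fun=> invmx (f x)) @ within D x^' --> invmx (f x) by exact: cvg_cst.
rewrite /has_derive_within.
apply: cvg_trans (cvg_oppmx (cvg_mulmx (cvg_mulmx fi fa) fc)).
apply: near_eq_cvg; apply: filterS uN => t ut; rewrite /diff_quotient.
rewrite -scalemxAr -scalemxAl -scalerN; congr (_ *: _).
by rewrite mulmxBr mulmxBl mulVmx// mul1mx -mulmxA mulmxV// mulmx1 opprB.
Qed.

Lemma mx_hausdorff m n : hausdorff_space 'M[C]_(m, n).
Proof. exact: norm_hausdorff. Qed.

Lemma has_derive_derivable D m n (f : R -> 'M[C]_(m, n)) x a :
  has_derive_within D f x a -> derivable_within D f x.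
Proof. by move=> fa; apply/cvg_ex; exists a. Qed.

Lemma derivable_has_derive D m n (f : R -> 'M[C]_(m, n)) x :
  derivable_within D f x -> has_derive_within D f x (derive_within D f x).
Proof. by []. Qed.

(** Without properness of the filter, that is if [x] were isolated in [D], every
    matrix would be a limit and [derive_within] would be arbitrary. *)
Lemma has_derive_lim D m n (f : R -> 'M[C]_(m, n)) x a :
  ProperFilter (within D x^') ->
  has_derive_within D f x a -> derive_within D f x = a.
Proof. by move=> PF fa; apply: cvg_lim fa; exact: mx_hausdorff. Qed.

Lemma ReR (a : R) (z : C) : complex.Re (a%:C * z) = a * complex.Re z.
Proof. by case: z => u v /=; rewrite mul0r subr0. Qed.

Lemma ImR (a : R) (z : C) : complex.Im (a%:C * z) = a * complex.Im z.
Proof. by case: z => u v /=; rewrite mul0r addr0. Qed.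

(** [is_derive] is about a quotient in the increment [h] at [0]; substituting
    [t = x + h] gives the form of [diff_quotient]. *)
Lemma is_derive_quotient (f : R -> R) (x l : R) : is_derive x 1 f l ->
  (t - x)^-1 * (f t - f x) @[t --> x^'] --> l.
Proof.
move=> [df <-].
have sh : (t - x) @[t --> x^'] --> (0 : R)^'.
  have cx : (t - x) @[t --> x] --> (0 : R).
    rewrite -[X in _ --> X](subrr x).
    by apply: cvgB; [exact: cvg_id|exact: cvg_cst].
  move=> P P0; change (nbhs x (fun t => t != x -> P (t - x))).
  have := cx (fun h => h != 0 -> P h) P0.
  apply: (@filterS _ (nbhs x)) => t /= + tx; apply.
  by rewrite subr_eq0.
apply: cvg_trans (cvg_comp _ _ sh df); apply: near_eq_cvg.
by apply: nearW => t /=; rewrite [_ *: 1]mulr1 subrK.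
Qed.

Lemma quotient_is_derive (f : R -> R) (x l : R) :
  (t - x)^-1 * (f t - f x) @[t --> x^'] --> l -> is_derive x 1 f l.
Proof.
move=> fl.
have sh : (h + x) @[h --> (0 : R)^'] --> x^'.
  have cx : (h + x) @[h --> (0 : R)] --> x.
    rewrite -[X in _ --> X]add0r.
    by apply: cvgD; [exact: cvg_id|exact: cvg_cst].
  move=> P Px; change (nbhs (0 : R) (fun h => h != 0 -> P (h + x))).
  have := cx (fun t => t != x -> P t) Px.
  apply: (@filterS _ (nbhs (0 : R))) => h /= + h0; apply.
  by rewrite -subr_eq0 addrK.
have fq : h^-1 *: ((f \o shift x) (h *: 1) - f x) @[h --> (0 : R)^'] --> l.
  apply: cvg_trans (cvg_comp _ _ sh fl); apply: near_eq_cvg.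
  by apply: nearW => h /=; rewrite [h *: 1]mulr1 addrK.
split; last by apply: cvg_lim fq; exact: Rhausdorff.
by apply/cvg_ex; exists l.
Qed.

(** Reduces to real calculus on each part of each entry; a two-sided limit implies
    the limit along any [D]. *)
Lemma has_derive_Re_Im (D : set R) p q (f : R -> 'M[C]_(p, q))
    (x : R) (l : 'M[C]_(p, q)) :
  (forall i j, (t - x)^-1 * (complex.Re (f t i j) - complex.Re (f x i j))
    @[t --> x^'] --> complex.Re (l i j)) ->
  (forall i j, (t - x)^-1 * (complex.Im (f t i j) - complex.Im (f x i j))
    @[t --> x^'] --> complex.Im (l i j)) ->
  has_derive_within D f x l.
Proof.
move=> dre dim; apply: (@has_derive_sub _ setT) => //.
apply/cvg_mxP => i j.
have -> : within setT x^' = x^' by exact: withinET.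
apply/cvg_complexP; split.
- apply: cvg_trans (dre i j); apply: near_eq_cvg.
  by apply: nearW => t; rewrite !mxE ReR raddfB.
- apply: cvg_trans (dim i j); apply: near_eq_cvg.
  by apply: nearW => t; rewrite !mxE ImR raddfB.
Qed.

(** The mean value theorem, applied to the parts of the entries. *)
Lemma has_derive0_cst p q (f : R -> 'M[C]_(p, q)) :
  (forall x, has_derive_within setT f x 0) -> forall x, f x = f 0.
Proof.
move=> df x; apply/matrixP => i j.
have dq t : (s - t)^-1 * (complex.Re (f s i j) - complex.Re (f t i j))
      @[s --> t^'] --> (0 : R) /\
    (s - t)^-1 * (complex.Im (f s i j) - complex.Im (f t i j))
      @[s --> t^'] --> (0 : R).
  have := df t; rewrite /has_derive_within withinET => /cvg_mxP/(_ i j).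
  rewrite mxE => /cvg_complexP[re im]; split.
  - apply: cvg_trans re; apply: near_eq_cvg.
    by apply: nearW => s; rewrite !mxE ReR raddfB.
  - apply: cvg_trans im; apply: near_eq_cvg.
    by apply: nearW => s; rewrite !mxE ImR raddfB.
have re := @is_derive_0_is_cst _ (fun t => complex.Re (f t i j)) x 0
  (fun t => quotient_is_derive (dq t).1).
have im := @is_derive_0_is_cst _ (fun t => complex.Im (f t i j)) x 0
  (fun t => quotient_is_derive (dq t).2).
by apply/eqP; rewrite eq_complex re im !eqxx.
Qed.

End RelativeDerivative.

(** * The matrix exponential *)

Section Exponential.
Variable R : realType.
Local Notation C := R[i].

(** Comparison with the series of [K exp (b |x|)]. *)
Lemma is_cvg_pseries_fact (c : nat -> R) (K b x : R) : 0 <= K -> 0 <= b ->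
  (forall k, `|c k| <= K * b ^+ k) -> cvgn (pseries (fun k => c k / k`!%:R) x).
Proof.
move=> K0 b0 cb; apply: normed_cvg; rewrite /normed_series_of.
apply: (@series_le_cvg _ _ (fun k => K * exp_coeff (b * `|x|) k)).
- by move=> k /=.
- by move=> k /=; apply: mulr_ge0 => //; apply: exp_coeff_ge0; apply: mulr_ge0.
- move=> k /=; rewrite /exp_coeff /= !normrM normfV normrX normr_nat.
  rewrite mulrAC exprMn !mulrA ler_pM2r ?invr_gt0 ?ltr0n ?fact_gt0//.
  by rewrite ler_wpM2r// exprn_ge0.
- by apply: is_cvg_seriesZ; exact: is_cvg_series_exp_coeff.
Qed.

(** Termwise differentiation shifts the coefficients [c k], because
    [(k + 1) / (k + 1)! = 1 / k!]; the shifted sequence obeys the same kind of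
    bound, so the radius of convergence is infinite for all the derivatives. *)
Lemma is_derive_pseries_fact (c : nat -> R) (K b x : R) : 0 <= K -> 0 <= b ->
  (forall k, `|c k| <= K * b ^+ k) ->
  is_derive x 1 (fun t => limn (pseries (fun k => c k / k`!%:R) t))
    (limn (pseries (fun k => c k.+1 / k`!%:R) x)).
Proof.
move=> K0 b0 cb.
have dE (d : nat -> R) : pseries_diffs (fun k => d k / k`!%:R) =
    (fun k => d k.+1 / k`!%:R).
  apply/funext => k; rewrite /pseries_diffs factS natrM invfM.
  by rewrite mulrCA mulVKf.
have cS k : `|c k.+1| <= K * b * b ^+ k by rewrite -mulrA -exprS.
have cSS k : `|c k.+2| <= K * b ^+ 2 * b ^+ k by rewrite -mulrA -exprD.
rewrite -dE; apply: (@pseries_snd_diffs _ _ (`|x| + 1)); rewrite ?dE.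
- exact: is_cvg_pseries_fact K0 b0 cb.
- by apply: (is_cvg_pseries_fact _ b0 cS); rewrite ?mulr_ge0.
- by apply: (is_cvg_pseries_fact _ b0 cSS); rewrite ?mulr_ge0 ?exprn_ge0.
- by rewrite [ltRHS]ger0_norm ?ltrDl// addr_ge0.
Qed.

(** [b] is the sum of the moduli of all the entries of [M].  Multiplying by [M] on
    the right enlarges a bound on the entries at most by the largest column sum
    of moduli, which is at most [b]. *)
Lemma expmx_bound n (M : 'M[C]_n) : exists2 b : R, 0 <= b &
  forall k i j, `|(M ^+ k) i j| <= (b ^+ k)%:C.
Proof.
pose s : C := \sum_i \sum_j `|M i j|.
have s0 : 0 <= s by apply: sumr_ge0 => i _; apply: sumr_ge0.
have sE : s = (complex.Re s)%:C by rewrite RRe_real// ger0_real.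
exists (complex.Re s); first by rewrite -ler0c -sE.
elim=> [|k IH] i j.
  by rewrite expr0 mxE; case: (i == j); rewrite ?normr1 ?normr0// ler0c.
rewrite exprSr mxE.
apply: le_trans (ler_norm_sum _ _ _) _.
apply: (@le_trans _ _ (\sum_l (complex.Re s ^+ k)%:C * `|M l j|)).
  by apply: ler_sum => l _; rewrite normrM ler_wpM2r.
rewrite -mulr_sumr exprSr [leRHS]rmorphM ler_wpM2l//.
  by rewrite ler0c exprn_ge0// -ler0c -sE.
rewrite -[leRHS]sE; apply: ler_sum => l _.
by rewrite (bigD1 j)//= lerDl sumr_ge0.
Qed.

Lemma expmxZ n (c : C) (M : 'M[C]_n) k : (c *: M) ^+ k = c ^+ k *: M ^+ k.
Proof.
elim: k => [|k IH]; first by rewrite !expr0 scale1r.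
by rewrite !exprS IH -!mulmxE -scalemxAl -scalemxAr scalerA.
Qed.

Section OneParameterGroup.
Variables (n : nat) (M : 'M[C]_n).

Definition mexp_series (x : R) : nat -> 'M[C]_n :=
  [series (k`!%:R)^-1 *: (x%:C *: M) ^+ k]_k.

Lemma mexp_seriesE x N i j : mexp_series x N i j =
  \sum_(0 <= k < N) (x ^+ k / k`!%:R)%:C * (M ^+ k) i j.
Proof.
rewrite /mexp_series /series /= summxE; apply: eq_bigr => k _.
rewrite expmxZ scalerA mxE; congr (_ * _).
by rewrite mulrC rmorphM rmorphXn fmorphV rmorph_nat.
Qed.

Lemma Re_sum_pseries (c : nat -> C) (x : R) N :
  complex.Re (\sum_(0 <= k < N) (x ^+ k / k`!%:R)%:C * c k) =
  pseries (fun k => complex.Re (c k) / k`!%:R) x N.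
Proof.
rewrite /pseries /series /=.
rewrite (big_morph (@complex.Re R) (id1 := 0) (op1 := +%R)) //; last first.
  by move=> [? ?] [? ?].
by apply: eq_bigr => k _; rewrite ReR mulrC mulrCA mulrC.
Qed.

Lemma Im_sum_pseries (c : nat -> C) (x : R) N :
  complex.Im (\sum_(0 <= k < N) (x ^+ k / k`!%:R)%:C * c k) =
  pseries (fun k => complex.Im (c k) / k`!%:R) x N.
Proof.
rewrite /pseries /series /=.
rewrite (big_morph (@complex.Im R) (id1 := 0) (op1 := +%R)) //; last first.
  by move=> [? ?] [? ?].
by apply: eq_bigr => k _; rewrite ImR mulrC mulrCA mulrC.
Qed.

Lemma Re_Im_expmx_bound : exists2 b : R, 0 <= b & forall k i j,
  `|complex.Re ((M ^+ k) i j)| <= 1 * b ^+ k /\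
  `|complex.Im ((M ^+ k) i j)| <= 1 * b ^+ k.
Proof.
have [b b0 bM] := expmx_bound M; exists b => // k i j; rewrite !mul1r -!lecR.
split; apply: le_trans (bM k i j); [exact: normc_ge_Re|exact: Im_le_normc].
Qed.

(** Since [mexp] is a [lim], it is meaningful only once the series is known to
    converge; here entrywise, by comparison with a real exponential series. *)
Lemma mexp_series_cvg x : mexp_series x @ \oo --> mexp (x%:C *: M).
Proof.
suff : cvgn (mexp_series x) by [].
have [b b0 bM] := Re_Im_expmx_bound.
apply/cvg_ex; exists (\matrix_(i, j)
  (limn (pseries (fun k => complex.Re ((M ^+ k) i j) / k`!%:R) x) +i*
   limn (pseries (fun k => complex.Im ((M ^+ k) i j) / k`!%:R) x))).
apply/cvg_mxP => i j; rewrite mxE; under eq_cvg do rewrite mexp_seriesE.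
apply/cvg_complexP; split => /=.
- under eq_cvg do rewrite Re_sum_pseries.
  by apply: is_cvg_pseries_fact (@ler01 _) b0 _ => k; have [] := bM k i j.
- under eq_cvg do rewrite Im_sum_pseries.
  by apply: is_cvg_pseries_fact (@ler01 _) b0 _ => k; have [] := bM k i j.
Qed.

Lemma lim_Re_Im_mexp (x : R) i j :
  limn (pseries (fun k => complex.Re ((M ^+ k) i j) / k`!%:R) x) =
    complex.Re (mexp (x%:C *: M) i j) /\
  limn (pseries (fun k => complex.Im ((M ^+ k) i j) / k`!%:R) x) =
    complex.Im (mexp (x%:C *: M) i j).
Proof.
have /cvg_mxP/(_ i j) := @mexp_series_cvg x.
under eq_cvg do rewrite mexp_seriesE.
move=> /cvg_complexP[].
under eq_cvg do rewrite Re_sum_pseries; move=> re.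
under eq_cvg do rewrite Im_sum_pseries; move=> im.
by split; apply: cvg_lim => //; exact: Rhausdorff.
Qed.

(** The termwise derivative of the series, which is how [M exp (x M)] arises. *)
Lemma mul_mexp_seriesE x N i j : (M *m mexp_series x N) i j =
  \sum_(0 <= k < N) (x ^+ k / k`!%:R)%:C * (M ^+ k.+1) i j.
Proof.
rewrite mxE; under eq_bigr do rewrite mexp_seriesE mulr_sumr.
rewrite exchange_big; apply: eq_bigr => k _.
rewrite exprS -mulmxE mxE mulr_sumr; apply: eq_bigr => l _.
by rewrite mulrCA.
Qed.

Lemma lim_Re_Im_mul_mexp (x : R) i j :
  limn (pseries (fun k => complex.Re ((M ^+ k.+1) i j) / k`!%:R) x) =
    complex.Re ((M *m mexp (x%:C *: M)) i j) /\
  limn (pseries (fun k => complex.Im ((M ^+ k.+1) i j) / k`!%:R) x) =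
    complex.Im ((M *m mexp (x%:C *: M)) i j).
Proof.
have : M *m mexp_series x N @[N --> \oo] --> M *m mexp (x%:C *: M).
  by apply: cvg_mulmx (@mexp_series_cvg x); exact: cvg_cst.
move=> /cvg_mxP/(_ i j).
under eq_cvg do rewrite mul_mexp_seriesE.
move=> /cvg_complexP[].
under eq_cvg do rewrite (Re_sum_pseries (fun k => (M ^+ k.+1) i j)); move=> re.
under eq_cvg do rewrite (Im_sum_pseries (fun k => (M ^+ k.+1) i j)); move=> im.
by split; apply: cvg_lim => //; exact: Rhausdorff.
Qed.

Lemma has_derive_mexp (D : set R) (x : R) :
  has_derive_within D (fun t => mexp (t%:C *: M)) x (M *m mexp (x%:C *: M)).
Proof.
have [b b0 bM] := Re_Im_expmx_bound.
apply: has_derive_Re_Im => i j; apply: is_derive_quotient.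
- rewrite -(lim_Re_Im_mul_mexp x i j).1.
  have -> : (fun t : R => complex.Re (mexp (t%:C *: M) i j)) =
      (fun t => limn (pseries (fun k => complex.Re ((M ^+ k) i j) / k`!%:R) t)).
    by apply/funext => t; rewrite (lim_Re_Im_mexp t i j).1.
  apply: is_derive_pseries_fact (@ler01 _) b0 _ => k; exact: (bM k i j).1.
- rewrite -(lim_Re_Im_mul_mexp x i j).2.
  have -> : (fun t : R => complex.Im (mexp (t%:C *: M) i j)) =
      (fun t => limn (pseries (fun k => complex.Im ((M ^+ k) i j) / k`!%:R) t)).
    by apply/funext => t; rewrite (lim_Re_Im_mexp t i j).2.
  apply: is_derive_pseries_fact (@ler01 _) b0 _ => k; exact: (bM k i j).2.
Qed.

End OneParameterGroup.

Lemma mexp0 n : mexp (0 : 'M[C]_n) = 1%:M.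
Proof.
rewrite -[X in mexp X](scale0r (0 : 'M[C]_n)) -[X in X *: _]/(0%:C).
apply: cvg_lim; first exact: mx_hausdorff.
(* The partial sum of length zero is 0, all the others are 1. *)
apply: cvg_near_cst; exists 1 => // N /= N0.
apply/matrixP => i j; rewrite mexp_seriesE big_ltn// big_nat big1 => [|k].
  by rewrite expr0 divr1 mul1r addr0 expr0.
by case: k => // k _; rewrite expr0n mul0r mul0r.
Qed.

End Exponential.

(** * The integral *)

Section Integral.
Variable R : realType.
Local Notation C := R[i].
Local Notation mu := (@lebesgue_measure R).

Lemma continuous_itv_integrable (f : R -> R) (a b : R) : continuous f ->
  mu.-integrable `[a, b] (EFin \o f).
Proof.
move=> cf; apply: continuous_compact_integrable; first exact: segment_compact.
by apply: continuous_subspaceT => t; exact: cf.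
Qed.

(** A base point [a] to the left of both [0] and [t] removes the case
    distinction on the sign of [t]. *)
Lemma oriented_integralE (f : R -> R) (a t : R) : continuous f ->
  a <= 0 -> a <= t ->
  oriented_integral 0 t f =
  \int[mu]_(s in `[a, t]) f s - \int[mu]_(s in `[a, 0]) f s.
Proof.
move=> cf a0 a_t; have ci := continuous_itv_integrable _ _ cf.
have B (u v : R) : a <= u -> u <= v ->
    \int[mu]_(s in `[a, v]) f s - \int[mu]_(s in `[a, u]) f s =
    \int[mu]_(s in `[u, v]) f s.
  move=> au uv; rewrite Rintegral_itvB ?bnd_simp//.
  rewrite Rintegral_itv_obnd_cbnd//.
  by apply: integrableS (ci u v) => //; exact: subset_itv_oc_cc.
rewrite /oriented_integral; case: leP => [t0|/ltW t0].
  by rewrite (B 0 t).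
by rewrite -(B t 0)// opprB.
Qed.

(** The base point [a] is also to the left of [x], so that near [x] the integral
    differs by a constant from an integral over the segment from [a] to [t]. *)
Lemma oriented_integral_quotient (f : R -> R) (x : R) : continuous f ->
  (t - x)^-1 * (oriented_integral 0 t f - oriented_integral 0 x f)
    @[t --> x^'] --> f x.
Proof.
move=> cf; pose a := Num.min 0 x - 1.
have [a0 ax] : a <= 0 /\ a < x.
  rewrite /a; split; first by rewrite lerBlDr ge_min lerDl ler01.
  by rewrite ltrBlDr gt_min ltrDl ltr01 orbT.
have x1 : x < x + 1 by rewrite ltrDl.
have [dF F'] := continuous_FTC1_closed x1
  (continuous_itv_integrable a (x + 1) cf) ax (cf x).
pose F t := \int[mu]_(s in `[a, t]) f s.
have dF' : is_derive x 1 F (f x).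
  exact: DeriveDef dF (etrans (esym (derive1E _ _)) F').
apply: cvg_trans (is_derive_quotient dF'); apply: near_eq_cvg.
have at' : \forall t \near x, a < t by exact: lt_nbhsr.
apply: filterS (nbhs_dnbhs at') => t /ltW a_t.
rewrite (oriented_integralE cf a0 a_t) (oriented_integralE cf a0 (ltW ax)).
by rewrite opprB addrA subrK.
Qed.

Lemma has_derive_mx_integral (D : set R) m n (F : R -> 'M[C]_(m, n)) (x : R) :
  (forall t : R, F s @[s --> t] --> F t) ->
  has_derive_within D (fun t => mx_integral 0 t F) x (F x).
Proof.
move=> cF; apply: has_derive_Re_Im => i j.
- under eq_cvg do rewrite !mxE /=.
  apply: oriented_integral_quotient => t.
  by have /cvg_mxP/(_ i j)/cvg_complexP[] := cF t.
- under eq_cvg do rewrite !mxE /=.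
  apply: oriented_integral_quotient => t.
  by have /cvg_mxP/(_ i j)/cvg_complexP[] := cF t.
Qed.

Lemma has_derive_continuous m n (F : R -> 'M[C]_(m, n)) x a :
  has_derive_within setT F x a -> F t @[t --> x] --> F x.
Proof.
move=> /has_derive_cvg; rewrite withinET => /continuous_withinNx; exact.
Qed.

End Integral.

(** * Accumulation points *)

Section AccumulationPoints.
Variable R : realType.
Local Notation C := R[i].

(** The points [x + s (y - x)] with [s] in the unit interval stay in the
    interval and tend to [x] with [s]. *)
Lemma within_interval_proper (I : interval R) (x y : R) :
  x \in I -> y \in I -> y != x -> ProperFilter (within [set` I] x^').
Proof.
move=> xI yI yx; apply: Build_ProperFilter_ex => P PI.
pose g s : R := x + s * (y - x).
have gx : g s @[s --> (0 : R)^'+] --> x.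
  apply: cvg_at_right_filter.
  rewrite -[X in _ --> X]addr0 -[X in _ --> _ + X](mul0r (y - x)).
  by apply: cvgD; [exact: cvg_cst|apply: cvgMl; exact: cvg_id].
have Pg : \forall s \near (0 : R)^'+, g s != x -> g s \in I -> P (g s).
  exact: (gx (fun t => t != x -> t \in I -> P t) PI).
have [s [Ps s1 s0]] : exists s,
    [/\ g s != x -> g s \in I -> P (g s), s < 1 & 0 < s].
  apply: (@filter_ex _ (0 : R)^'+); near=> s; split; near: s => //.
  - exact: nbhs_right_lt.
  - exact: nbhs_right_gt.
exists (g s); apply: Ps.
  by rewrite /g addrC -subr_eq0 addrK mulf_neq0 ?subr_eq0// gt_eqF.
have itvI := @interval_is_interval _ I.
have [xy|xy] := leP x y.
- apply: (itvI x y) => //; rewrite /g lerDl mulr_ge0 ?subr_ge0 ?(ltW s0)//=.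
  by rewrite -lerBrDl ler_piMl ?subr_ge0// ltW.
- apply: (itvI y x) => //; rewrite /g gerDl.
  rewrite mulr_ge0_le0 ?subr_le0 ?(ltW s0) ?(ltW xy)// andbT.
  rewrite -lerBlDl -[leLHS]mul1r; rewrite ler_wnM2r ?subr_le0 ?(ltW xy)//.
  exact: ltW.
Unshelve. all: by end_near. Qed.

Lemma within_near_proper (D I : set R) (x : R) :
  ProperFilter (within I x^') -> (\forall t \near x, I t -> D t) ->
  ProperFilter (within D x^').
Proof.
move=> PI DI; apply: Build_ProperFilter_ex => P PD.
have : within I x^' P.
  change (nbhs x (fun t => t != x -> I t -> P t)).
  have PD' : nbhs x (fun t => t != x -> D t -> P t) by exact: PD.
  by apply: filterS2 DI PD' => t It Pt tx /It; exact: Pt.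
exact: filter_ex.
Qed.

End AccumulationPoints.

(** * The functions [Lambda1], [Lambda2], [S] and their identity *)

Section DarbouxData.
Variables (R : realType) (n h : nat).
Local Notation C := R[i].
Variables (S0 Q : 'M[C]_n) (f1 f2 : 'M[C]_(n, h)).
Local Notation L1 := (Lambda1 Q f1 f2).
Local Notation L2 := (Lambda2 Q f1 f2).
Local Notation S := (Smx S0 Q f1 f2).

Local Notation expp x := (mexp (('i%C * x%:C) *: Q) *m f1).
Local Notation expn x := (mexp (- (('i%C * x%:C) *: Q)) *m f2).

Lemma has_derive_exp_pos D (x : R) :
  has_derive_within D (fun t => expp t) x ('i%C *: (Q *m expp x)).
Proof.
have E (t : R) : ('i%C * t%:C) *: Q = t%:C *: ('i%C *: Q).
  by rewrite scalerA mulrC.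
rewrite mulmxA scalemxAl scalemxAl E.
have -> : (fun t => expp t) = (fun t => mexp (t%:C *: ('i%C *: Q)) *m f1).
  by apply/funext => t; rewrite E.
by apply: has_derive_mulmxr; exact: has_derive_mexp.
Qed.

Lemma has_derive_exp_neg D (x : R) :
  has_derive_within D (fun t => expn t) x (- ('i%C *: (Q *m expn x))).
Proof.
have E (t : R) : - (('i%C * t%:C) *: Q) = t%:C *: ((- 'i%C) *: Q).
  by rewrite scalerA mulrN scaleNr mulrC.
rewrite -scaleNr mulmxA scalemxAl scalemxAl E.
have -> : (fun t => expn t) = (fun t => mexp (t%:C *: ((- 'i%C) *: Q)) *m f2).
  by apply/funext => t; rewrite E.
by apply: has_derive_mulmxr; exact: has_derive_mexp.
Qed.

Lemma has_derive_Lambda2 D (x : R) : has_derive_within D L2 x (- L1 x).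
Proof.
have alg (a b : 'M[C]_(n, h)) :
    'i%C *: (Q *m a) + - ('i%C *: (Q *m b)) = - ((- 'i%C) *: (Q *m (a - b))).
  by rewrite scaleNr opprK mulmxBr scalerBr.
have := has_derive_add (@has_derive_exp_pos D x) (@has_derive_exp_neg D x).
by rewrite alg.
Qed.

Lemma has_derive_Lambda1 D (x : R) : has_derive_within D L1 x (Q ^+ 2 *m L2 x).
Proof.
have alg (a b : 'M[C]_(n, h)) :
    ((- 'i%C) *: Q) *m ('i%C *: (Q *m a) + - - ('i%C *: (Q *m b))) =
    Q ^+ 2 *m (a + b).
  rewrite opprK -scalerDr -mulmxDr -scalemxAl -scalemxAr scalerA mulNr.
  by rewrite -[X in - X]expr2 sqr_i opprK scale1r mulmxA.
have := has_derive_mulmxl (b := (- 'i%C) *: Q) (has_derive_add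
  (@has_derive_exp_pos D x) (has_derive_opp (@has_derive_exp_neg D x))).
rewrite alg; congr has_derive_within.
by apply/funext => t; rewrite /Lambda1 [RHS]scalemxAl.
Qed.

Lemma has_derive_Smx D (x : R) :
  has_derive_within D S x (L2 x *m (L2 x)^t*).
Proof.
rewrite -[X in has_derive_within _ _ _ X]add0r.
apply: has_derive_add; first exact: has_derive_cst.
apply: (has_derive_mx_integral _ (F := fun t => L2 t *m (L2 t)^t*)) => t.
have cL := has_derive_continuous (@has_derive_Lambda2 setT t).
exact: cvg_mulmx cL (cvg_trmxC cL).
Qed.

Lemma Lambda1_0 : L1 0 = (- 'i%C) *: (Q *m (f1 - f2)).
Proof. by rewrite /Lambda1 mulr0 scale0r oppr0 mexp0 !mul1mx. Qed.

Lemma Lambda2_0 : L2 0 = f1 + f2.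
Proof. by rewrite /Lambda2 mulr0 scale0r oppr0 mexp0 !mul1mx. Qed.

Lemma Smx_0 : S 0 = S0.
Proof.
rewrite /Smx -[RHS]addr0; congr (_ + _); apply/matrixP => i j.
by rewrite !mxE /oriented_integral lexx set_itv1 !Rintegral_set1.
Qed.

Lemma row_mx_jmx p (a b c d : 'M[C]_(n, p)) :
  row_mx a b *m jmx R p *m (row_mx c d)^t* = a *m d^t* - b *m c^t*.
Proof.
rewrite /jmx mul_row_block !mulmx0 add0r addr0 mulmx1 mulmxN mulmx1.
by rewrite tr_row_mx map_col_mx mul_row_col mulNmx addrC.
Qed.

(** By [Lambda1' = A Lambda2], [Lambda2' = - Lambda1] and
    [S' = Lambda2 Lambda2^*], both sides have the derivative
    [A Lambda2 Lambda2^* - Lambda2 Lambda2^* A^*], with [A = Q^2]. *)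
Lemma Smx_identity :
  Q ^+ 2 *m S0 - S0 *m (Q ^+ 2)^t* =
    row_mx (L1 0) (L2 0) *m jmx R h *m (row_mx (L1 0) (L2 0))^t* ->
  forall x, Q ^+ 2 *m S x - S x *m (Q ^+ 2)^t* =
    L1 x *m (L2 x)^t* - L2 x *m (L1 x)^t*.
Proof.
rewrite row_mx_jmx => id0 x; apply/eqP; rewrite -subr_eq0; apply/eqP.
pose G t := Q ^+ 2 *m S t - S t *m (Q ^+ 2)^t* -
  (L1 t *m (L2 t)^t* - L2 t *m (L1 t)^t*).
suff G0 : forall t, has_derive_within setT G t 0.
  by rewrite -/(G x) (has_derive0_cst G0 x) /G Smx_0 id0 subrr.
have alg (A : 'M[C]_n) (a b : 'M[C]_(n, h)) :
    A *m (b *m b^t*) + - (b *m b^t* *m A^t*) +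
    - (A *m b *m b^t* + a *m (- a)^t* +
       - (- a *m a^t* + b *m (A *m b)^t*)) = 0.
  rewrite linearN /= map_mxN trmx_mul map_mxM /= mulmxN mulNmx !mulmxA.
  move: (A *m _ *m _) (a *m _) (b *m _ *m _) => u v w.
  by apply/matrixP => i j; rewrite !mxE; ring.
move=> t.
have dL1 := @has_derive_Lambda1 setT t; have dL2 := @has_derive_Lambda2 setT t.
have dS := @has_derive_Smx setT t.
have := has_derive_add
  (has_derive_add (has_derive_mulmxl (b := Q ^+ 2) dS)
    (has_derive_opp (has_derive_mulmxr (b := (Q ^+ 2)^t*) dS)))
  (has_derive_opp (has_derive_add (has_derive_mulmx dL1 (has_derive_trmxC dL2))
     (has_derive_opp (has_derive_mulmx dL2 (has_derive_trmxC dL1))))).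
by rewrite alg.
Qed.

End DarbouxData.

(** * Dressing a solution *)

(** Apply [S A^* = A S - a b^* + b a^* ] to [v] and use that [A] acts on
    [S v = (A - lambda)^-1 (a p + b q)] as [lambda] up to [a p + b q]. *)
Lemma adjoint_resolvent (R : realType) n h (A S : 'M[R[i]]_n)
    (a b : 'M[R[i]]_(n, h)) (lambda : R[i]) (p q : 'cV[R[i]]_h)
    (v : 'cV[R[i]]_n) :
  S \in unitmx -> A - lambda%:M \in unitmx ->
  A *m S - S *m A^t* = a *m b^t* - b *m a^t* ->
  S *m v = invmx (A - lambda%:M) *m (a *m p + b *m q) ->
  A^t* *m v = lambda *: v +
    invmx S *m (a *m (p - b^t* *m v) + b *m (q + a^t* *m v)).
Proof.
move=> uS uA AS Sv.
have ASv : A *m (S *m v) = lambda *: (S *m v) + (a *m p + b *m q).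
  rewrite -[X in _ = _ + X](mulKVmx uA) -Sv mulmxBl mul_scalar_mx.
  by rewrite addrC subrK.
move: (A^t*) (a^t*) (b^t*) AS => A' a' b' AS.
have SAv : S *m (A' *m v) = A *m (S *m v) - (a *m b' - b *m a') *m v.
  by rewrite -AS mulmxBl -!mulmxA opprB addrC subrK.
apply: (can_inj (mulKmx uS)).
rewrite mulmxDr (mulKVmx uS) -scalemxAr SAv ASv.
rewrite mulmxBr mulmxDr mulmxBl -!mulmxA.
move: (lambda *: _) (a *m p) (b *m q) (a *m (b' *m v)) (b *m (a' *m v)).
move=> c d e f k.
by apply/matrixP => i j; rewrite !mxE; ring.
Qed.

(** What remains of the equation once the derivatives are computed:  [y] and [w]
    stand for [y] and [Lambda2^* v], [z] for the new solution and [p] for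
    [y' + Lambda1^* v]. *)
Lemma schrodinger_algebra (R : realType) h (lambda : R[i])
    (X12 X21 X22 : 'M[R[i]]_h) (y w p z : 'cV[R[i]]_h) : z = y - w ->
  - (- (lambda *: y) + (lambda *: w + (X21 *m z + X22 *m p) + X12 *m z) +
     - (- (X12 + X21 + X22 *m X22) *m z + X22 *m (p - X22 *m z))) +
  (2%:R *: (X12 + X21 + X22 ^+ 2)) *m z = lambda *: z.
Proof.
move=> zE.
have -> : lambda *: z = lambda *: y - lambda *: w by rewrite zE scalerBr.
rewrite mulNmx expr2 -mulmxE -scalemxAl !mulmxDl mulmxBr -mulmxA.
move: (X22 *m p) (X12 *m z) (X21 *m z) (X22 *m (X22 *m z)) => a b c d.
by apply/matrixP => i j; rewrite !mxE; ring.
Qed.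

(** The dressing argument uses the differential relations between [L1], [L2],
    [S] and the identity for [A S - S A^*] only, so the explicit exponentials are
    left out of it. *)
Section Dressing.
Variables (R : realType) (n h : nat).
Local Notation C := R[i].
Variables (D : set R) (A : 'M[C]_n) (L1 L2 : R -> 'M[C]_(n, h)).
Variables (S : R -> 'M[C]_n) (lambda : C) (y0 y1 : R -> 'cV[C]_h).
Hypothesis D_proper : forall x, D x -> ProperFilter (within D x^').
Hypothesis dL1 : forall x, D x -> has_derive_within D L1 x (A *m L2 x).
Hypothesis dL2 : forall x, D x -> has_derive_within D L2 x (- L1 x).
Hypothesis dS : forall x, D x -> has_derive_within D S x (L2 x *m (L2 x)^t*).
Hypothesis S_unit : forall x, D x -> S x \in unitmx.
Hypothesis AS : forall x, D x ->
  A *m S x - S x *m A^t* = L1 x *m (L2 x)^t* - L2 x *m (L1 x)^t*.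
Hypothesis A_unit : A - lambda%:M \in unitmx.
Hypothesis dy0 : forall x, D x -> has_derive_within D y0 x (y1 x).
Hypothesis dy1 : forall x, D x -> has_derive_within D y1 x (- (lambda *: y0 x)).

Let g x := invmx (A - lambda%:M) *m (L1 x *m y0 x + L2 x *m y1 x).
Let v x := invmx (S x) *m g x.

Definition dressed x : 'cV[C]_h := y0 x - (L2 x)^t* *m v x.

Let X (La Lb : R -> 'M[C]_(n, h)) x : 'M[C]_h :=
  (La x)^t* *m invmx (S x) *m Lb x.

Definition dressed_derivative x : 'cV[C]_h :=
  y1 x + (L1 x)^t* *m v x - X L2 L2 x *m dressed x.

(** [L1' y + L2 y'' = A L2 y - lambda L2 y], while [L1 y'] and [L2' y']
    cancel. *)
Lemma has_derive_g x : D x -> has_derive_within D g x (L2 x *m y0 x).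
Proof.
move=> Dx.
have := has_derive_mulmxl (b := invmx (A - lambda%:M)) (has_derive_add
  (has_derive_mulmx (dL1 Dx) (dy0 Dx)) (has_derive_mulmx (dL2 Dx) (dy1 Dx))).
congr has_derive_within.
rewrite mulNmx mulmxN -scalemxAr addrA addrK -mulmxA.
by rewrite -mul_scalar_mx -mulmxBl mulKmx.
Qed.

(** The derivative of [S^-1] contributes [- S^-1 L2 L2^* v], which turns the [y]
    of the derivative of [g] into [y - L2^* v]. *)
Lemma has_derive_v x : D x ->
  has_derive_within D v x (invmx (S x) *m (L2 x *m dressed x)).
Proof.
move=> Dx.
have := has_derive_mulmx (has_derive_invmx (S_unit Dx) S_unit (dS Dx))
  (has_derive_g Dx).
congr has_derive_within.
rewrite /dressed mulmxBr mulmxBr mulNmx addrC; congr (_ - _).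
by rewrite /v; move: (g x) => gx; rewrite !mulmxA.
Qed.

Lemma has_derive_dressed x : D x ->
  has_derive_within D dressed x (dressed_derivative x).
Proof.
move=> Dx.
have := has_derive_add (dy0 Dx) (has_derive_opp
  (has_derive_mulmx (has_derive_trmxC (dL2 Dx)) (has_derive_v Dx))).
congr has_derive_within.
rewrite /dressed_derivative /X linearN /= map_mxN mulNmx opprD opprK addrA.
by rewrite !mulmxA.
Qed.

Lemma has_derive_X22 x : D x -> has_derive_within D (X L2 L2) x
  (- (X L1 L2 x + X L2 L1 x + X L2 L2 x *m X L2 L2 x)).
Proof.
move=> Dx.
have := has_derive_mulmx (has_derive_mulmx (has_derive_trmxC (dL2 Dx))
  (has_derive_invmx (S_unit Dx) S_unit (dS Dx))) (dL2 Dx).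
congr has_derive_within.
rewrite /X linearN /= map_mxN !mulNmx !mulmxN mulmxDl !mulNmx !mulmxA !opprD.
by rewrite addrAC.
Qed.

Lemma adjoint_dressed x : D x -> A^t* *m v x = lambda *: v x +
  invmx (S x) *m (L1 x *m dressed x + L2 x *m (y1 x + (L1 x)^t* *m v x)).
Proof.
move=> Dx; apply: adjoint_resolvent (S_unit Dx) A_unit (AS Dx) _.
by rewrite mulKVmx ?S_unit.
Qed.

Lemma schrodinger_dressed :
  schrodinger_on D
    (fun x => 2%:R *: (X L1 L2 x + X L2 L1 x + X L2 L2 x ^+ 2)) lambda dressed.
Proof.
have d1 x : D x -> derive_within D dressed x = dressed_derivative x.
  by move=> Dx; exact: has_derive_lim (D_proper Dx) (has_derive_dressed Dx).
move=> x Dx.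
have := has_derive_add (has_derive_add (dy1 Dx)
  (has_derive_mulmx (has_derive_trmxC (dL1 Dx)) (has_derive_v Dx)))
  (has_derive_opp
    (has_derive_mulmx (has_derive_X22 Dx) (has_derive_dressed Dx))).
move=> /(has_derive_eq Dx (fun t Dt => esym (d1 t Dt))) d2.
split.
- exact: has_derive_derivable (has_derive_dressed Dx).
- exact: has_derive_derivable d2.
rewrite (has_derive_lim (D_proper Dx) d2).
have -> : (A *m L2 x)^t* *m v x = lambda *: ((L2 x)^t* *m v x) +
    (X L2 L1 x *m dressed x + X L2 L2 x *m (y1 x + (L1 x)^t* *m v x)).
  rewrite trmx_mul map_mxM -mulmxA (adjoint_dressed Dx) mulmxDr -scalemxAr.
  by rewrite /X; move: (dressed x) (y1 x + _) => z p; rewrite !mulmxDr !mulmxA.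
have -> : (L1 x)^t* *m (invmx (S x) *m (L2 x *m dressed x)) =
    X L1 L2 x *m dressed x.
  by rewrite /X !mulmxA.
exact: schrodinger_algebra.
Qed.

End Dressing.

(** * The theorem *)

(** The first block row of [j Pi^*] is [b^*], where [Pi] has the blocks [a]
    and [b]. *)
Lemma upper_block_wA (R : realType) n h (a b : 'M[R[i]]_(n, h))
    (T U : 'M[R[i]]_n)
    (p q : 'cV[R[i]]_h) :
  row_mx 1%:M 0 *m
    (1%:M - jmx R h *m (row_mx a b)^t* *m T *m U *m row_mx a b) *m col_mx p q =
  p - b^t* *m (T *m (U *m (a *m p + b *m q))).
Proof.
rewrite mulmxBr mulmx1 mulmxBl mul_row_col mul1mx mul0mx addr0; congr (_ - _).
rewrite -!mulmxA mul_row_col tr_row_mx map_col_mx.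
rewrite (mulmxA (jmx R h)) /jmx mul_block_col !mul0mx !mul1mx add0r.
by rewrite (mulmxA (row_mx _ _)) mul_row_col mul1mx mul0mx addr0.
Qed.

Lemma schrodinger_on_eq (R : realType) h (D : set R) (u : R -> 'M[R[i]]_h)
    (lambda : R[i]) (z w : R -> 'cV[R[i]]_h) :
  z =1 w -> schrodinger_on D u lambda z -> schrodinger_on D u lambda w.
Proof. by move=> /funext->. Qed.

Lemma unitmx_sub_eigenvalue (F : fieldType) n (A : 'M[F]_n) (a : F) :
  ~~ eigenvalue A a -> A - a%:M \in unitmx.
Proof.
rewrite /eigenvalue /eigenspace negbK kermx_eq0 => free.
by rewrite -row_free_unit.
Qed.

Theorem theorem2p3 (R : realType) (n h : nat) (n_gt0 : (0 < n)%N)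
    (h_gt0 : (0 < h)%N)
    (I : interval R) (I0 : 0 \in I) (I_nondeg : exists2 t : R, t \in I & t != 0)
    (A S0 Q : 'M[R[i]]_n) (theta1 theta2 f1 f2 : 'M[R[i]]_(n, h))
    (AS0 : A *m S0 - S0 *m A^t*
           = row_mx theta1 theta2 *m jmx R h *m (row_mx theta1 theta2)^t*)
    (S0_herm : S0 = S0^t*)
    (Q2 : Q ^+ 2 = A)
    (f12_theta1 : (- 'i%C) *: (Q *m (f1 - f2)) = theta1)
    (f12_theta2 : f1 + f2 = theta2)
    (lambda : R[i]) (lambda_A : ~~ eigenvalue A lambda)
    (y : R -> 'cV[R[i]]_h)
    (y_eq : forall x : R, x \in I ->
      [/\ derivable_within [set` I] y x,
          derivable_within [set` I] (derive_within [set` I] y) x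
        & - derive_within [set` I] (derive_within [set` I] y) x
          = lambda *: y x]) :
  schrodinger_on [set x : R | x \in I /\ Smx S0 Q f1 f2 x \in unitmx]
    (utilde S0 Q f1 f2) lambda
    (ytilde A S0 Q f1 f2 lambda y (derive_within [set` I] y)).
Proof.
set D := [set x : R | _]; set dy := derive_within [set` I] y.
have DI : D `<=` [set` I] by move=> x [].
have D_proper x : D x -> ProperFilter (within D x^').
  move=> [xI ux]; apply: (@within_near_proper _ _ [set` I]).
    (* One of [0] and [t] is a point of the interval other than [x]. *)
    have [<-|x0] := eqVneq 0 x; last exact: within_interval_proper xI I0 x0.
    by have [t tI t0] := I_nondeg; exact: within_interval_proper I0 tI t0.
  have detS : \det (Smx S0 Q f1 f2 t) @[t --> x] --> \det (Smx S0 Q f1 f2 x).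
    apply: cvg_det; apply: (@has_derive_continuous _ _ _ _ x).
    exact: has_derive_Smx.
  have det0 : \det (Smx S0 Q f1 f2 x) != 0.
    by move: ux; rewrite unitmxE unitfE.
  have norm0 : 0 < `|\det (Smx S0 Q f1 f2 x)| by rewrite normr_gt0.
  (* Closer to the limit than its modulus, the determinant cannot vanish. *)
  move/cvgrPdist_lt/(_ _ norm0) : detS.
  apply: filterS => t dt tI; split; first exact: tI.
  rewrite unitmxE unitfE.
  by apply/negP => /eqP dt0; move: dt; rewrite dt0 subr0 ltxx.
have dyD x : D x -> has_derive_within D y x (dy x).
  move=> /DI xI; have [dyx _ _] := y_eq x xI.
  exact: has_derive_sub DI (derivable_has_derive dyx).
have ddyD x : D x -> has_derive_within D dy x (- (lambda *: y x)).
  move=> /DI xI; have [_ ddyx <-] := y_eq x xI; rewrite opprK.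
  exact: has_derive_sub DI (derivable_has_derive ddyx).
have AS x : A *m Smx S0 Q f1 f2 x - Smx S0 Q f1 f2 x *m A^t* =
    Lambda1 Q f1 f2 x *m (Lambda2 Q f1 f2 x)^t* -
    Lambda2 Q f1 f2 x *m (Lambda1 Q f1 f2 x)^t*.
  rewrite -Q2; apply: Smx_identity.
  by rewrite Lambda1_0 Lambda2_0 f12_theta1 f12_theta2 Q2.
apply: (@schrodinger_on_eq _ _ _ _ _
  (dressed A (Lambda1 Q f1 f2) (Lambda2 Q f1 f2) (Smx S0 Q f1 f2) lambda y dy)).
  by move=> x; rewrite /ytilde /wA /Pimx upper_block_wA.
apply: schrodinger_dressed => //.
- by move=> x _; rewrite -Q2; exact: has_derive_Lambda1.
- by move=> x _; exact: has_derive_Lambda2.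
- by move=> x _; exact: has_derive_Smx.
- by move=> x [].
- exact: unitmx_sub_eigenvalue.
Qed.
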